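(* Let $n\ge 1$ be an integer and write $n=2^q+r$ with integers $q\ge 0$, $0\le r<2^q$. Every factor $w$ of the infinite Thue--Morse word $t$ of length $n$ uniquely determines at least $u_{\min}(n)$ and at most $u_{\max}(n)$ letters, where \[u_{\min}(n):=\begin{cases}0 & \text{for } n=1,\\ 0 & \text{for } n=2,\\ 0 & \text{for } n=3,\\ (-n) \operatorname{Mod} 2^{q-1} & \text{for } n>3,\end{cases}\qquad u_{\max}(n):=\begin{cases}0 & \text{for } n=1,\\ 2 & \text{for } n=2,\\ 1 & \text{for } n=3,\\ 2^{\lfloor \log_2(n-2)\rfloor+2}-n & \text{for } n>3.\end{cases}\] These bounds are sharp, i.e. for every $n\ge 1$ there is a factor of length $n$ that uniquely determines exactly $u_{\min}(n)$ letters and a factor of length $n$ that uniquely determines exactly $u_{\max}(n)$ letters.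
   Context: The infinite Thue--Morse word is $t=\lim_{n\to\infty} m^n(0)=0110100110010110\cdots$, where $m$ is the morphism $0\mapsto 01$, $1\mapsto 10$. $T$ denotes the set of finite factors of $t$. For integers $a$ and $b>0$, $a\operatorname{Mod} b:=a-\lfloor a/b\rfloor b$. An extension of $w\in T$ is a pair $(v_1,v_2)$ of (possibly empty) words in $T$ with $|v_1|+|v_2|>0$ and $v_1wv_2\in T$. An extension $(v_1,v_2)$ is unique if for all pairs $(y_1,y_2)\in\{0,1\}^*\times\{0,1\}^*$ with $|y_1|=|v_1|$, $|y_2|=|v_2|$ and $(y_1,y_2)\ne(v_1,v_2)$ one has $y_1wy_2\notin T$. The number of letters uniquely determined by $w$ is the maximum of $|v_1|+|v_2|$ over all unique extensions $(v_1,v_2)$ of $w$ (and $0$ if $w$ has no unique extension). *)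

(* Defs.v *)
From mathcomp Require Import all_boot all_order all_algebra.

Set Implicit Arguments.
Unset Strict Implicit.
Unset Printing Implicit Defensive.

Import Order.TTheory GRing.Theory Num.Theory.

(* Words over {0,1}; the letter 0 is [false] and the letter 1 is [true]. *)
Definition word := seq bool.

(* The morphism 0 |-> 01, 1 |-> 10. *)
Definition tm_morphism (w : word) : word :=
  flatten [seq (if a then [:: true; false] else [:: false; true]) | a <- w].

Definition tm_prefix (n : nat) : word := iter n tm_morphism [:: false].

(* The infinite word lim m^n(0): m^i(0) has length 2^i > i, and each m^n(0) is
   a prefix of the next one; [tm_prefixE] states that every m^n(0) is a prefix
   of [thue_morse]. *)
Definition thue_morse (i : nat) : bool := nth false (tm_prefix i) i.

Lemma tm_morphism_cat (u v : word) :
  tm_morphism (u ++ v) = tm_morphism u ++ tm_morphism v.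
Proof. by rewrite /tm_morphism map_cat flatten_cat. Qed.

Lemma size_tm_prefix (n : nat) : size (tm_prefix n) = 2 ^ n.
Proof.
have size_m (w : word) : size (tm_morphism w) = 2 * size w.
  elim: w => [|a w IHw] //.
  by rewrite -cat1s tm_morphism_cat size_cat IHw /= mulnS; case: a.
by elim: n => [|n IHn] //; rewrite /tm_prefix iterS size_m -/(tm_prefix n) IHn expnS.
Qed.

Lemma tm_prefix_le (m n : nat) : m <= n -> prefix (tm_prefix m) (tm_prefix n).
Proof.
elim: n => [|n IHn]; first by rewrite leqn0 => /eqP ->; apply: prefix_refl.
rewrite leq_eqVlt => /predU1P [-> | le_mn]; first exact: prefix_refl.
apply: (prefix_trans (IHn le_mn)) => {IHn le_mn}.
elim: n => [|n IHn] //.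
case/prefixP: IHn => s Es; apply/prefixP.
exists (tm_morphism s); rewrite -tm_morphism_cat.
exact: (congr1 tm_morphism Es).
Qed.

Lemma tm_prefixE (n : nat) : tm_prefix n = mkseq thue_morse (2 ^ n).
Proof.
apply: (@eq_from_nth _ false); rewrite size_tm_prefix ?size_mkseq // => i lt_i.
rewrite nth_mkseq // /thue_morse.
have lt_i2 : i < 2 ^ i by apply: ltn_expl.
case/orP: (leq_total i n) => /tm_prefix_le /prefixP [s ->];
  by rewrite nth_cat size_tm_prefix ?lt_i ?lt_i2.
Qed.

(* The set T of finite factors of the infinite word (including [::]). *)
Definition tm_factor (w : word) : Prop :=
  exists i : nat, w = mkseq (fun j => thue_morse (i + j)) (size w).

Definition extension (w v1 v2 : word) : Prop :=
  [/\ tm_factor v1, tm_factor v2, 0 < size v1 + size v2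
    & tm_factor (v1 ++ w ++ v2)].

Definition unique_extension (w v1 v2 : word) : Prop :=
  extension w v1 v2 /\
  forall y1 y2 : word, size y1 = size v1 -> size y2 = size v2 ->
    (y1, y2) <> (v1, v2) -> ~ tm_factor (y1 ++ w ++ y2).

(* A relation rather than a function: it does not presuppose that the maximum
   exists, which is part of the claim whenever some [k] is asserted to satisfy
   it. *)
Definition uniquely_determines (w : word) (k : nat) : Prop :=
  ((exists v1 v2 : word, unique_extension w v1 v2 /\ size v1 + size v2 = k) /\
   (forall v1 v2 : word, unique_extension w v1 v2 -> size v1 + size v2 <= k))
  \/ ((forall v1 v2 : word, ~ unique_extension w v1 v2) /\ k = 0).

Local Open Scope ring_scope.

(* [(a %% b)%Z] is a - floor(a/b) b for b > 0.  [q] stands for the exponent in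
   n = 2^q + r with r < 2^q, so q >= 2 in the last case and [q.-1] is exact. *)
Definition u_min (n q : nat) : int :=
  match n with
  | 0 | 1 | 2 | 3 => 0
  | _ => ((- n%:Z) %% (2 ^ q.-1)%N%:Z)%Z
  end.

Definition u_max (n : nat) : int :=
  match n with
  | 0 | 1 => 0
  | 2 => 2
  | 3 => 1
  | _ => (2 ^ (trunc_log 2 (n - 2) + 2))%N%:Z - n%:Z
  end.

(* Main.v *)
Require Import Defs.
From mathcomp Require Import all_boot all_order all_algebra.
From mathcomp Require Import zify.

Set Implicit Arguments.
Unset Strict Implicit.
Unset Printing Implicit Defensive.

(** Every letter that a factor w determines can be collected into a single
    factor x containing w, its hull: every occurrence of w in t sits, at a
    fixed offset, inside an occurrence of x, and x is bispecial, i.e. both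
    letters may precede it and both may follow it. A unique extension of w can
    then reach no further than x on either side, so w determines exactly
    |x| - |w| letters ([hull_uniquely_determines]). The theorem thus becomes a
    pair of sharp bounds on the length of the hull.

    Hulls are computed by desubstitution. Since t contains no cube of a letter,
    the occurrences of a word w of length at least 4 all start at positions of
    the same parity ([window_parity]). So w is m(w') with at most one letter
    removed at each end, for a factor w' that is the same for all occurrences
    of w, and the occurrences of w are exactly the images of those of w'. The
    morphism m preserves bispecial factors, because the two letters that
    surround the image on either side still depend injectively on the original
    ones; hence the hull of w is m(x) whenever x is the hull of w'
    ([hull_cut]): the length of the hull doubles.

    A factor w of length n > 3 comes from a w' of length between uphalf n and
    n/2 + 1, and both extreme lengths can be realised from any w' of that
    length. The bounds on the hull therefore satisfy
      min(n) = 2 min(uphalf n)  and  max(n) = 2 max(n/2 + 1),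
    with starting values read off from the factors of length at most 3
    ([hull_small]), whose hulls are 0, 01, 010 and 0110 up to exchange
    of the two letters. The closed forms
    [hull_min] and [hull_max] solve these recurrences. *)

(** * Windows of the Thue-Morse word *)

Local Notation t := thue_morse.

Definition window (i n : nat) : word := mkseq (fun j => t (i + j)) n.

Lemma size_window i n : size (window i n) = n.
Proof. exact: size_mkseq. Qed.

Lemma nth_window i n j : j < n -> nth false (window i n) j = t (i + j).
Proof. exact: nth_mkseq. Qed.

Lemma windowS i n : window i n.+1 = t i :: window i.+1 n.
Proof.
rewrite /window /mkseq /= addn0 -[1]addn0 iotaDl -map_comp.
by congr (_ :: _); apply: eq_map => j /=; rewrite addnS.
Qed.

Lemma window_cat i m n : window i (m + n) = window i m ++ window (i + m) n.
Proof.
elim: m i => [|m IHm] i; first by rewrite addn0.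
by rewrite addSn !windowS IHm addSnnS.
Qed.

Lemma window_eqP i j n :
  (forall k, k < n -> t (i + k) = t (j + k)) <-> window i n = window j n.
Proof.
split=> [eq_t | eq_w k lt_k]; last by rewrite -!(@nth_window _ n) // eq_w.
by apply: (@eq_from_nth _ false) => [|k]; rewrite !size_window // => lt_k;
  rewrite !nth_window // eq_t.
Qed.

Lemma factor_window i n : tm_factor (window i n).
Proof. by exists i; rewrite size_window. Qed.

Lemma factorP w : tm_factor w <-> exists i, window i (size w) = w.
Proof. by split=> -[i Ew]; exists i. Qed.

Lemma window_split i x y z :
  window i (size (x ++ y ++ z)) = x ++ y ++ z ->
  [/\ window i (size x) = x, window (i + size x) (size y) = y
    & window (i + size x + size y) (size z) = z].
Proof.
rewrite !size_cat !window_cat => /eqP.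
rewrite eqseq_cat ?size_window // => /andP[/eqP-> ].
by rewrite eqseq_cat ?size_window // => /andP[/eqP-> /eqP->].
Qed.

Lemma factor_infix x y z : tm_factor (x ++ y ++ z) -> tm_factor y.
Proof. by case/factorP=> i /window_split[_ <- _]; apply: factor_window. Qed.

Lemma factor_prefix n w : infix w (tm_prefix n) -> tm_factor w.
Proof.
case/infixP=> x [z Ew]; apply: (@factor_infix x w z).
by rewrite -Ew tm_prefixE -[mkseq _ _]/(window 0 _); apply: factor_window.
Qed.

(** * The morphism, recurrence and parity *)

Lemma tm_morphism_cons a w :
  tm_morphism (a :: w) = a :: ~~ a :: tm_morphism w.
Proof. by case: a. Qed.

Lemma size_tm_morphism w : size (tm_morphism w) = (size w).*2.
Proof. by elim: w => // a w IHw; rewrite tm_morphism_cons /= IHw. Qed.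

Lemma nth_tm_morphism w i : i < size w ->
  nth false (tm_morphism w) i.*2 = nth false w i /\
  nth false (tm_morphism w) i.*2.+1 = ~~ nth false w i.
Proof.
by elim: w i => // a w IHw [|i] lt_i; rewrite tm_morphism_cons //=; apply: IHw.
Qed.

Lemma thue_morse_double i : t i.*2 = t i /\ t i.*2.+1 = ~~ t i.
Proof.
have lt_i : i < 2 ^ i by apply: ltn_expl.
have := @nth_tm_morphism (tm_prefix i) i; rewrite size_tm_prefix => /(_ lt_i).
rewrite -[tm_morphism _]/(tm_prefix i.+1) !tm_prefixE !nth_mkseq //;
  rewrite expnS; lia.
Qed.

Lemma thue_morse_half i : t i = odd i (+) t i./2.
Proof.
rewrite -{1}[i]odd_double_half; have [t0 t1] := thue_morse_double i./2.
by case: (odd i); rewrite ?add0n ?add1n ?t0 ?t1.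
Qed.

Lemma window_double i n : window i.*2 n.*2 = tm_morphism (window i n).
Proof.
elim: n i => [|n IHn] i //.
have [t0 t1] := thue_morse_double i.
by rewrite doubleS !windowS tm_morphism_cons -IHn t0 t1.
Qed.

Lemma factor_morphism w : tm_factor w -> tm_factor (tm_morphism w).
Proof.
by case/factorP=> i <-; rewrite -window_double; apply: factor_window.
Qed.

(** Below [2 ^ k] the word t repeats itself from position [2 ^ k * 3] on: the
    block number 3 of length [2 ^ k] is the image under the k-th power of m of
    the letter of t at position 3, which is 0 like the letter at position 0. *)
Lemma thue_morse_shift k i : i < 2 ^ k -> t (2 ^ k * 3 + i) = t i.
Proof.
elim: k i => [|k IHk] i lt_i; first by case: i lt_i.
rewrite thue_morse_half (thue_morse_half i) -(IHk i./2); last first.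
  by move: lt_i; rewrite expnS; lia.
rewrite expnS; congr (_ (+) t _); lia.
Qed.

(** t is only infinite to the right; recurrence provides occurrences with
    arbitrarily much room on their left. *)
Lemma factor_recurrent w b : tm_factor w ->
  exists2 i, b <= i & window i (size w) = w.
Proof.
case/factorP=> i Ew; set k := i + size w + b.
have lt_k : k < 2 ^ k by apply: ltn_expl.
exists (2 ^ k * 3 + i); first lia.
rewrite -{2}Ew; apply/window_eqP => j lt_j.
by rewrite -addnA thue_morse_shift //; lia.
Qed.

(** Of two adjacent equal letters the first sits at an odd position, since the
    pairs starting at even positions are images of a letter. *)
Lemma thue_morse_no_cube i : t i = t i.+1 -> t i.+1 = t i.+2 -> False.
Proof.
rewrite -[i]odd_double_half.
have [a0 a1] := thue_morse_double i./2.
have [b0 b1] := thue_morse_double i./2.+1.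
rewrite doubleS in b0 b1.
case: (odd i); rewrite ?add0n ?add1n ?a0 ?a1 ?b0 ?b1.
  by case: (t i./2.+1).
by case: (t i./2).
Qed.

(** If a window of length 4 occurs at an even and at an odd position, the
    comparison of the two decompositions into images of letters produces three
    equal consecutive letters. Length 3 is not enough: 010 is a prefix of
    m(00) and a suffix of m(11). *)
Lemma window_parity n i j : 3 < n -> window i n = window j n -> odd i = odd j.
Proof.
move=> n_gt3.
have clash k l : odd k = false -> odd l = true ->
    window k n = window l n -> False.
  move=> even_k odd_l Ew.
  have Et m : m < 4 -> t (k + m) = t (l + m).
    by move=> lt_m; apply: (proj2 (window_eqP k l n)) => //; apply: leq_trans n_gt3.
  move: (Et 0 isT) (Et 1 isT) (Et 2 isT) (Et 3 isT).
  rewrite -[k]odd_double_half -[l]odd_double_half odd_l even_k.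
  rewrite !addnS !addn0 !add1n !add0n.
  have [a0 a1] := thue_morse_double k./2.
  have [b0 b1] := thue_morse_double k./2.+1.
  have [c0 c1] := thue_morse_double l./2.
  have [d0 d1] := thue_morse_double l./2.+1.
  have [e0 e1] := thue_morse_double l./2.+2.
  rewrite !doubleS in b0 b1 d0 d1 e0 e1.
  rewrite a0 a1 b0 b1 c1 d0 d1 e0 => -> E2 E3 E4.
  apply: (@thue_morse_no_cube l./2); move: E2 E3 E4;
    by case: (t l./2); case: (t l./2.+1); case: (t l./2.+2); case: (t k./2.+1).
move=> Ew; case oi: (odd i); case oj: (odd j) => //.
  by case: (clash _ _ oj oi (esym Ew)).
by case: (clash _ _ oi oj Ew).
Qed.

(** * Hulls and uniquely determined letters *)

Definition bispecial (x : word) : Prop :=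
  (forall c, tm_factor (c :: x)) /\ (forall c, tm_factor (rcons x c)).

Lemma bispecial_factor x : bispecial x -> tm_factor x.
Proof.
by case=> Lx _; apply: (@factor_infix [:: true] x [::]); rewrite cats0; apply: Lx.
Qed.

(** Only the occurrences of [w] that leave room for [a] letters on the left are
    constrained, because positions in t start at 0. *)
Definition forces (w : word) (a : nat) (x : word) : Prop :=
  forall i, window (i + a) (size w) = w -> window i (size x) = x.

Definition hull (w x : word) : Prop :=
  bispecial x /\ exists a : nat, a + size w <= size x /\ forces w a x.

Lemma factor_cat_window v1 w v2 i :
  window (i + size v1) (size w) = w ->
  exists y1 y2, [/\ size y1 = size v1, size y2 = size v2
    & window i (size (v1 ++ w ++ v2)) = y1 ++ w ++ y2].
Proof.
move=> Ew; exists (window i (size v1)), (window (i + size v1 + size w) (size v2)).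
by rewrite !size_window !size_cat !window_cat Ew.
Qed.

Lemma unique_extension_forces w v1 v2 :
  unique_extension w v1 v2 -> forces w (size v1) (v1 ++ w ++ v2).
Proof.
move=> [_ uniq_v] i /(factor_cat_window v2)[y1 [y2 [sz1 sz2 Ey]]].
rewrite Ey; case: (eqVneq (y1, y2) (v1, v2)) => [[-> ->] // | /eqP neq_y].
by case: (uniq_v y1 y2) => //; rewrite -Ey; apply: factor_window.
Qed.

Lemma forces_unique_extension w v1 v2 :
  0 < size v1 + size v2 -> tm_factor (v1 ++ w ++ v2) ->
  forces w (size v1) (v1 ++ w ++ v2) -> unique_extension w v1 v2.
Proof.
move=> sz_gt0 Fx Hx; split; first split=> //.
- exact: (@factor_infix [::] v1 (w ++ v2)).
- by apply: (@factor_infix (v1 ++ w) v2 [::]); rewrite cats0 -catA.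
move=> y1 y2 sz1 sz2 neq_y /factorP[i Ei].
have [_ Ew _] := window_split Ei.
have sz : size (y1 ++ w ++ y2) = size (v1 ++ w ++ v2) by rewrite !size_cat sz1 sz2.
rewrite sz1 in Ew; have /eqP := Hx _ Ew.
rewrite -sz Ei eqseq_cat // eqseq_cat // => /andP[/eqP e1 /andP[_ /eqP e2]].
by apply: neq_y; rewrite e1 e2.
Qed.

Lemma forces_sub w a x : tm_factor w -> a + size w <= size x -> forces w a x ->
  exists v1 v2, x = v1 ++ w ++ v2 /\ size v1 = a.
Proof.
move=> Fw le_x Hx; have [i le_i Ew] := factor_recurrent a Fw.
have := Hx (i - a); rewrite subnK // => /(_ Ew).
have -> : size x = a + (size w + (size x - a - size w)) by lia.
rewrite !window_cat subnK // Ew => Ex; rewrite -Ex.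
by eexists _, _; split; first reflexivity; rewrite size_window.
Qed.

(** A forced word cannot reach beyond a bispecial one: if it did, the letter of
    [z] next to [v1 ++ w ++ v2] would have to equal both letters, by looking at
    an occurrence of the bispecial word for each choice of its neighbour. *)
Lemma forces_bispecial_sub w v1 v2 a z :
  bispecial (v1 ++ w ++ v2) -> a <= size z -> forces w a z ->
  a <= size v1 /\ size z <= a + size w + size v2.
Proof.
set x := v1 ++ w ++ v2 => -[Lx Rx] le_a Hz; split; rewrite leqNgt; apply/negP => lt.
- suff Ec c : c = nth false z (a - (size v1).+1) by have := Ec true; rewrite -(Ec false).
  have [i le_i] := factor_recurrent a (Lx c); rewrite windowS => -[Ec Ex].
  have [_ Ew _] := window_split Ex.
  have := Hz (i.+1 + size v1 - a); rewrite subnK; last lia.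
  move=> /(_ Ew) <-; rewrite nth_window; last lia.
  rewrite -Ec; congr t; lia.
suff Ec c : c = nth false z (a + size w + size v2) by have := Ec true; rewrite -(Ec false).
have [i le_i] := factor_recurrent a (Rx c).
rewrite -cats1 size_cat /= window_cat => /eqP.
rewrite eqseq_cat ?size_window // => /andP[/eqP Ex /eqP[Ec]].
have [_ Ew _] := window_split Ex.
have := Hz (i + size v1 - a); rewrite subnK; last lia.
move=> /(_ Ew) <-; rewrite nth_window // -Ec; congr t.
rewrite addn0 !size_cat; lia.
Qed.

(** The hull itself yields a unique extension unless it is [w], and
    [forces_bispecial_sub] bounds each side of any other one. *)
Lemma hull_uniquely_determines w x : tm_factor w -> hull w x ->
  size w <= size x /\ uniquely_determines w (size x - size w).
Proof.
move=> Fw [Bx [a [le_x Hx]]]; split; first lia.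
have Fx := bispecial_factor Bx.
have [v1 [v2 [Ex sz1]]] := forces_sub Fw le_x Hx; subst a.
have max_v y1 y2 : unique_extension w y1 y2 ->
    size y1 + size y2 <= size x - size w.
  move=> /unique_extension_forces; set z := y1 ++ _ => Hz.
  have [] := @forces_bispecial_sub w v1 v2 (size y1) z _ _ Hz.
  - by rewrite -Ex.
  - by rewrite size_cat leq_addr.
  by rewrite Ex !size_cat; lia.
case: (posnP (size v1 + size v2)) => [sz0 | sz_gt0]; [right | left].
  have sz_x : size x - size w = 0 by rewrite Ex !size_cat; lia.
  split=> // y1 y2 Uy; have := max_v _ _ Uy; rewrite sz_x.
  by have [[_ _ sz_gt0 _] _] := Uy; lia.
split=> //; exists v1, v2; split; last by rewrite Ex !size_cat; lia.
by apply: forces_unique_extension => //; rewrite -Ex.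
Qed.

(** * Hulls of cut images under the morphism *)

(** The image of the letter before [x] ends with its complement and the image
    of the letter after [x] begins with that letter; both choices survive. *)
Lemma bispecial_morphism x : bispecial x -> bispecial (tm_morphism x).
Proof.
move=> [Lx Rx]; split=> c.
- apply: (@factor_infix [:: ~~ c] _ [::]); rewrite cats0.
  have := factor_morphism (Lx (~~ c)).
  by rewrite tm_morphism_cons negbK.
apply: (@factor_infix [::] _ [:: ~~ c]).
have := factor_morphism (Rx c); rewrite -!cats1 tm_morphism_cat tm_morphism_cons.
by rewrite /= -catA.
Qed.

(** Words of length at least 4 are written as [take n (drop e (tm_morphism w))]
    with [e <= 1]; where the constraint [n + e <= (size w).*2 <= n + e + 1]
    appears, at most one letter is lost at the right end as well. *)
Lemma cut_window Q m e n : e <= 1 -> n + e <= m.*2 ->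
  take n (drop e (tm_morphism (window Q m))) = window (Q.*2 + e) n.
Proof.
move=> e_le1 le_m; rewrite -window_double.
have -> : m.*2 = e + (n + (m.*2 - n - e)) by lia.
by rewrite !window_cat drop_size_cat ?size_window // take_size_cat ?size_window.
Qed.

(** Every letter of the preimage leaves at least one of its two image letters
    in the cut image, and either of them determines it. *)
Lemma cut_inj Q R m e n :
  3 < n -> e <= 1 -> n + e <= m.*2 <= n + e + 1 ->
  window (Q.*2 + e) n = window (R.*2 + e) n -> window Q m = window R m.
Proof.
move=> n_gt3 e_le1 /andP[le_m ge_m] /window_eqP Et; apply/window_eqP => k lt_k.
case: (ltnP k.*2 e) => [lt_e | ge_e].
  have k0 : k = 0 by lia.
  have e1 : e = 1 by lia.
  (* The first image letter is cut off; the second one is its complement. *)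
  subst k e; have := Et 0 ltac:(lia); rewrite !addn0 !addn1.
  by rewrite !(proj2 (thue_morse_double _)) => /negb_inj.
have := Et (k.*2 - e) ltac:(lia).
have -> : Q.*2 + e + (k.*2 - e) = (Q + k).*2 by lia.
have -> : R.*2 + e + (k.*2 - e) = (R + k).*2 by lia.
by rewrite !(proj1 (thue_morse_double _)).
Qed.

(** By parity an occurrence of the cut image comes from an occurrence of [w],
    which extends to [x]; then the image extends to [tm_morphism x]. *)
Lemma hull_cut w x e n : tm_factor w -> hull w x ->
  3 < n -> e <= 1 -> n + e <= (size w).*2 <= n + e + 1 ->
  hull (take n (drop e (tm_morphism w))) (tm_morphism x).
Proof.
move=> /factorP[Q Ew] [Bx [a [le_x Hx]]] n_gt3 e_le1 le_w.
have le_n : n + e <= (size w).*2 by case/andP: le_w.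
split; first exact: bispecial_morphism.
rewrite -Ew cut_window // /hull /forces size_window size_tm_morphism.
exists (a.*2 + e); split; first lia.
move=> i Ei.
have even_i : odd i = false.
  have := window_parity n_gt3 Ei; rewrite !oddD !odd_double addFb /=.
  by case: (odd i); case: (odd e).
have Ei2 : i = i./2.*2 by rewrite -{1}[i]odd_double_half even_i.
rewrite Ei2 window_double Hx // -{2}Ew; apply: (@cut_inj _ _ _ e n) => //.
by rewrite -Ei; congr window; lia.
Qed.

Lemma factor_cut w e n : tm_factor w -> e <= 1 -> n + e <= (size w).*2 ->
  tm_factor (take n (drop e (tm_morphism w))).
Proof.
by case/factorP=> Q <- e_le1 le_n; rewrite size_window in le_n *;
  rewrite cut_window //; apply: factor_window.
Qed.

Lemma factor_cutP w : tm_factor w -> exists w' e,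
  [/\ tm_factor w', e <= 1, size w + e <= (size w').*2 <= size w + e + 1
    & w = take (size w) (drop e (tm_morphism w'))].
Proof.
case/factorP=> i Ew; exists (window i./2 (uphalf (size w + odd i))), (odd i).
have le_m : size w + odd i <= (uphalf (size w + odd i)).*2 by lia.
rewrite size_window; split; [exact: factor_window | by case: odd | lia |].
by rewrite cut_window ?leq_b1 // addnC odd_double_half.
Qed.

(** * Factors of length at most three *)

Lemma bispecial_infix n x : 
  (forall c, infix (c :: x) (tm_prefix n) && infix (rcons x c) (tm_prefix n)) ->
  bispecial x.
Proof. by move=> H; split=> c; apply: (@factor_prefix n); have /andP[] := H c. Qed.

Lemma bispecial1 c : bispecial [:: c].
Proof. by apply: (@bispecial_infix 5) => -[]; case: c; vm_compute. Qed.
Lemma bispecial2 c : bispecial [:: c; ~~ c].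
Proof. by apply: (@bispecial_infix 5) => -[]; case: c; vm_compute. Qed.
Lemma bispecial3 c : bispecial [:: c; ~~ c; c].
Proof. by apply: (@bispecial_infix 5) => -[]; case: c; vm_compute. Qed.
Lemma bispecial4 c : bispecial [:: ~~ c; c; c; ~~ c].
Proof. by apply: (@bispecial_infix 5) => -[]; case: c; vm_compute. Qed.

Lemma hull_bispecial x : bispecial x -> hull x x.
Proof. by move=> Bx; split=> //; exists 0; split=> // i; rewrite addn0. Qed.

(** A third [c] on either side would be a cube. *)
Lemma square_forces c : forces [:: c; c] 1 [:: ~~ c; c; c; ~~ c].
Proof.
move=> i; rewrite !windowS addn1 => -[E1 E2].
have := @thue_morse_no_cube i; have := @thue_morse_no_cube i.+1.
rewrite E1 E2; case: (t i); case: (t i.+3); case: c {E1 E2} => //= H1 H2;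
 by [case: (H1 erefl erefl) | case: (H2 erefl erefl)].
Qed.

Lemma forces_infix w1 w2 v1 v2 a x :
  w2 = v1 ++ w1 ++ v2 -> forces w1 (a + size v1) x -> forces w2 a x.
Proof. 
move=> -> Hx i /window_split[_ Ew _]; apply: Hx.
by rewrite addnA.
Qed.

Lemma hull_small w : tm_factor w -> 0 < size w <= 3 ->
  exists2 x, hull w x &
  size x \in nth [::] [:: [::]; [:: 1]; [:: 2; 4]; [:: 3; 4]] (size w).
Proof.
case: w => [|a [|b [|c [|]]]] // Fw _.
- by exists [:: a] => //; apply/hull_bispecial/bispecial1.
- case: (eqVneq b a) => [-> | neq].
    exists [:: ~~ a; a; a; ~~ a] => //; split; first exact: bispecial4.
    by exists 1; split=> //; apply: square_forces.
  have -> : b = ~~ a by case: (a) neq; case: (b).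
  by exists [:: a; ~~ a] => //; apply/hull_bispecial/bispecial2.
case/factorP: Fw => i; rewrite !windowS => -[Ea Eb Ec].
have := @thue_morse_no_cube i; rewrite Ea Eb Ec => nc.
case: (eqVneq b a) => [ba | neq].
  exists [:: ~~ a; a; a; ~~ a] => //; split; first exact: bispecial4.
  exists 1; split=> //; apply: (@forces_infix [:: a; a] _ [::] [:: c]) => //.
    by rewrite ba.
  exact: square_forces.
case: (eqVneq c b) => [cb | neq2].
  exists [:: ~~ b; b; b; ~~ b] => //; split; first exact: bispecial4.
  exists 0; split=> //; apply: (@forces_infix [:: b; b] _ [:: a] [::]) => //.
    by rewrite cb.
  exact: square_forces.
exists [:: a; ~~ a; a] => //.
have -> : b = ~~ a by case: (a) neq; case: (b).
have -> : c = a by case: (a) (b) (c) neq neq2 => -[] [].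
exact/hull_bispecial/bispecial3.
Qed.

(** * Lengths of hulls *)

(** [n] rounded up to a multiple of [2 ^ (q - 1)], where q is the integer part
    of log2 n. *)
Definition hull_min (n : nat) : nat :=
  let d := 2 ^ (trunc_log 2 n).-1 in (n + d.-1) %/ d * d.

(** For [n = 2] the truncated logarithm of 0 is 0, giving 4, and this is also
    the value for [n = 3], so that only [n = 1] is exceptional. *)
Definition hull_max (n : nat) : nat :=
  if n == 1 then 1 else 2 ^ (trunc_log 2 (n - 2) + 2).

Lemma hull_minP n : let d := 2 ^ (trunc_log 2 n).-1 in
  [/\ 0 < d, d %| hull_min n & n <= hull_min n < n + d].
Proof.
move=> d; have d_gt0 : 0 < d by rewrite expn_gt0.
split; rewrite // /hull_min -/d ?dvdn_mull //.
have := divn_eq (n + d.-1) d; have := ltn_pmod (n + d.-1) d_gt0; lia.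
Qed.

Lemma hull_min_least n m :
  n <= m -> 2 ^ (trunc_log 2 n).-1 %| m -> hull_min n <= m.
Proof.
move=> le_nm /dvdnP[k Em]; have [d_gt0 /dvdnP[j Ej] /andP[_]] := hull_minP n.
move: d_gt0 Ej Em; set d := 2 ^ _ => d_gt0 -> Em lt_j.
rewrite Em leq_pmul2r // -ltnS -(ltn_pmul2r d_gt0) mulSn -Em.
by rewrite (leq_trans lt_j) // addnC leq_add2l.
Qed.

(** The rounding step grows by powers of 2 with [n], so a value rounded for [n]
    is also a multiple of the step for [m]. *)
Lemma hull_min_homo m n : m <= n -> hull_min m <= hull_min n.
Proof.
move=> le_mn; have [_ dvd_n /andP[le_n _]] := hull_minP n.
apply: hull_min_least; first exact: leq_trans le_n.
apply: dvdn_trans dvd_n; apply: dvdn_exp2l.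
by rewrite -!subn1 leq_sub2r // leq_trunc_log.
Qed.

Lemma trunc_log_double n : 0 < n ->
  trunc_log 2 n.*2 = (trunc_log 2 n).+1 /\ trunc_log 2 n.*2.+1 = (trunc_log 2 n).+1.
Proof.
move=> n_gt0; have /andP[] := trunc_log_bounds (isT : 1 < 2) n_gt0.
rewrite expnS => lo hi.
by split; apply: trunc_log_eq => //; rewrite !expnS; lia.
Qed.

(** The rounding step of [uphalf n] is half the one of [n], except when
    [n = 2 ^ (q + 1) - 1]: there [uphalf n] is a power of 2 and is its own
    rounding, whichever of the two steps is used. *)
Lemma hull_min_uphalf n : 3 < n -> hull_min n = (hull_min (uphalf n)).*2.
Proof.
move=> n_gt3; apply/eqP; rewrite eqn_leq.
have h_gt1 : 1 < n./2 by lia.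
have u_gt0 : 0 < uphalf n by lia.
have q_gt0 : 0 < trunc_log 2 n./2 by rewrite trunc_log_gt0.
have En : trunc_log 2 n = (trunc_log 2 n./2).+1.
  rewrite -{1}[n]odd_double_half.
  by have [] := @trunc_log_double n./2 ltac:(lia); case: (odd n).
have Ed : 2 ^ (trunc_log 2 n).-1 = (2 ^ (trunc_log 2 n./2).-1).*2.
  by rewrite En /= -{1}(prednK q_gt0) expnS mul2n.
have dvd2 : 2 ^ (trunc_log 2 n./2).-1 %| 2 ^ (trunc_log 2 (uphalf n)).-1.
  by apply: dvdn_exp2l; rewrite -!subn1 leq_sub2r // leq_trunc_log //; lia.
apply/andP; split.
  have [_ dvd_h /andP[le_h _]] := hull_minP (uphalf n).
  apply: hull_min_least; first by lia.
  by rewrite Ed -!mul2n dvdn_pmul2l //; apply: dvdn_trans dvd_h.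
have [_ /dvdnP[k Ek] /andP[le_n _]] := hull_minP n.
rewrite Ed in Ek.
suff : hull_min (uphalf n) <= k * 2 ^ (trunc_log 2 n./2).-1 by lia.
have le_k : uphalf n <= k * 2 ^ (trunc_log 2 n./2).-1 by lia.
case: (eqVneq (trunc_log 2 (uphalf n)) (trunc_log 2 n./2)) => [Eu | neq].
  by apply: hull_min_least => //; rewrite Eu dvdn_mull.
(* The exceptional case, with [uphalf n] a power of 2. *)
have lt_log : trunc_log 2 n./2 < trunc_log 2 (uphalf n).
  by rewrite ltn_neqAle eq_sym neq leq_trunc_log //; lia.
have /andP[lo _] := trunc_log_bounds (isT : 1 < 2) u_gt0.
have /andP[_ hi] := trunc_log_bounds (isT : 1 < 2) (ltnW h_gt1).
have le_exp := leq_pexp2l (isT : 0 < 2) lt_log.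
apply: leq_trans le_k; apply: hull_min_least => //.
have -> : uphalf n = 2 ^ (trunc_log 2 (uphalf n)) by lia.
by rewrite trunc_expnK // dvdn_exp2l // leq_pred.
Qed.

Lemma hull_max_homo m n : 1 < m -> m <= n -> hull_max m <= hull_max n.
Proof.
move=> m_gt1 le_mn; rewrite /hull_max !gtn_eqF //; last lia.
by rewrite leq_pexp2l // leq_add2r leq_trunc_log // leq_sub2r.
Qed.

Lemma hull_max_half n : 3 < n -> hull_max n = (hull_max n./2.+1).*2.
Proof.
move=> n_gt3; rewrite /hull_max !gtn_eqF //; [|lia|lia].
rewrite -mul2n -expnS; congr (2 ^ _); rewrite -addSn; congr (_ + _).
have [E0 E1] := @trunc_log_double (n./2.+1 - 2) ltac:(lia).
case oddn: (odd n); [rewrite -E1 | rewrite -E0]; congr trunc_log; lia.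
Qed.

Lemma hull_bounds w : tm_factor w -> 0 < size w ->
  exists2 x, hull w x & hull_min (size w) <= size x <= hull_max (size w).
Proof.
have [n] := ubnP (size w); elim: n w => // n IHn w lt_w Fw w_gt0.
case: (leqP (size w) 3) => [le3 | n_gt3].
  have [|x Hx sz_x] := @hull_small w Fw; first lia.
  exists x => //; move: sz_x le3 w_gt0.
  by case: (size w) => [|[|[|[|]]]] //= + _ _; rewrite !inE;
    do ?[case/orP]; move=> /eqP ->; vm_compute.
have [w' [e [Fw' e_le1 le_w Ew]]] := factor_cutP Fw.
have [||x Hx /andP[lo hi]] := IHn w' _ Fw'; [lia | lia |].
exists (tm_morphism x); first by rewrite {1}Ew; apply: hull_cut.
rewrite size_tm_morphism hull_min_uphalf // hull_max_half // !leq_double.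
have [le1 le2] : uphalf (size w) <= size w' /\ size w' <= (size w)./2.+1 by lia.
by rewrite (leq_trans (hull_min_homo le1)) // (leq_trans hi) // hull_max_homo //; lia.
Qed.

(** Desubstitution run backwards: a factor of length [h n] realising [F] is
    mapped to one of length [n], by cutting [e] letters at the left end of its
    image. The minimum uses [h = uphalf] and [e = 0], the maximum the longest
    preimages, with a letter cut at the left end. *)
Lemma hull_sharp (F : nat -> nat) (h : nat -> nat) (e : nat) :
  e <= 1 ->
  (forall n, 3 < n -> F n = (F (h n)).*2 /\ n + e <= (h n).*2 <= n + e + 1) ->
  (forall n, 0 < n <= 3 -> exists w x,
    [/\ tm_factor w, size w = n, hull w x & size x = F n]) ->
  forall n, 0 < n -> exists w x,
    [/\ tm_factor w, size w = n, hull w x & size x = F n].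
Proof.
move=> e_le1 step base n; have [m] := ubnP n; elim: m n => // m IHm n lt_n n_gt0.
case: (leqP n 3) => [le3 | n_gt3]; first by apply: base; rewrite n_gt0.
have [EF le_h] := step n n_gt3.
have [||w [x [Fw sz_w Hx sz_x]]] := IHm (h n); [lia | lia |].
have le_n : n + e <= (size w).*2 by rewrite sz_w; case/andP: le_h.
exists (take n (drop e (tm_morphism w))), (tm_morphism x).
split; first exact: factor_cut.
- by rewrite size_takel // size_drop size_tm_morphism; lia.
- by apply: hull_cut; rewrite // sz_w.
by rewrite size_tm_morphism sz_x EF.
Qed.

Lemma hull_min_sharp n : 0 < n ->
  exists w x, [/\ tm_factor w, size w = n, hull w x & size x = hull_min n].
Proof.
apply: (@hull_sharp _ uphalf 0) => // {}n.
  by move=> n_gt3; split; [exact: hull_min_uphalf | lia].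
have use x : bispecial x -> size x = hull_min (size x) ->
    exists w y, [/\ tm_factor w, size w = size x, hull w y
                 & size y = hull_min (size x)].
  by move=> Bx sz_x; exists x, x; split=> //; [apply: bispecial_factor | apply: hull_bispecial].
case: n => [|[|[|[|]]]] // _.
- exact: (use _ (bispecial1 false) erefl).
- exact: (use _ (bispecial2 false) erefl).
exact: (use _ (bispecial3 false) erefl).
Qed.

Lemma hull_max_sharp n : 0 < n ->
  exists w x, [/\ tm_factor w, size w = n, hull w x & size x = hull_max n].
Proof.
apply: (@hull_sharp _ (fun n => n./2.+1) 1) => // {}n.
  by move=> n_gt3; split; [exact: hull_max_half | lia].
case: n => [|[|[|[|]]]] // _.
- exists [:: false], [:: false]; split=> //.
    by apply: (@factor_prefix 5).
  exact/hull_bispecial/bispecial1.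
- exists [:: true; true], [:: false; true; true; false]; split=> //.
    by apply: (@factor_prefix 5).
  by split; [exact: (bispecial4 true) | exists 1; split=> //; exact: square_forces].
exists [:: true; true; false], [:: false; true; true; false]; split=> //.
  by apply: (@factor_prefix 5).
split; [exact: (bispecial4 true) | exists 1; split=> //].
apply: (@forces_infix [:: true; true] _ [::] [:: false]) => //.
exact: square_forces.
Qed.

(** * The bounds of the theorem *)

Lemma u_minE n q : 0 < n -> trunc_log 2 n = q ->
  ((hull_min n - n)%N%:Z = u_min n q)%R.
Proof.
move=> n_gt0 <-; case: n n_gt0 => [|[|[|[|n]]]] // _.
set m := n.+4; rewrite -[u_min m _]/((- m%:Z) %% (2 ^ (trunc_log 2 m).-1)%N%:Z)%Z.
have [d_gt0 /dvdnP[k Ek] /andP[le_m lt_m]] := hull_minP m.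
move: (2 ^ _) d_gt0 Ek lt_m => d d_gt0 Ek lt_m.
have -> : (- m%:Z = (- k%:Z) * d%:Z + (hull_min m - m)%N%:Z)%R by lia.
by rewrite modzMDl modz_small //; lia.
Qed.

Lemma u_maxE n : 0 < n -> ((hull_max n)%:Z - n%:Z = u_max n)%R.
Proof. by case: n => [|[|[|[|n]]]]. Qed.

Theorem theorem3p4 (n q r : nat) (n_ge1 : (1 <= n)%N)
    (n_eq : n = (2 ^ q + r)%N) (r_lt : (r < 2 ^ q)%N) :
  (forall w : word, tm_factor w -> size w = n ->
     exists k : nat, uniquely_determines w k /\
       (u_min n q <= k%:Z <= u_max n)%R) /\
  (exists w : word, exists k : nat,
     [/\ tm_factor w, size w = n, uniquely_determines w k & (k%:Z = u_min n q)%R]) /\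
  (exists w : word, exists k : nat,
     [/\ tm_factor w, size w = n, uniquely_determines w k & (k%:Z = u_max n)%R]).
Proof.
have log_n : trunc_log 2 n = q by apply: trunc_log_eq => //; rewrite expnS; lia.
have Emin := u_minE n_ge1 log_n; have Emax := u_maxE n_ge1.
have [_ _ /andP[le_min _]] := hull_minP n.
split; [|split].
- move=> w Fw sz_w; have [|x Hx] := hull_bounds Fw; rewrite sz_w // => le_x.
  have [_ Ux] := hull_uniquely_determines Fw Hx.
  by exists (size x - n); rewrite -{1}sz_w; split=> //; rewrite -Emin -Emax; lia.
- have [w [x [Fw sz_w Hx sz_x]]] := hull_min_sharp n_ge1.
  have [_ Ux] := hull_uniquely_determines Fw Hx.
  by exists w, (size x - n); split; rewrite // -?Emin -?sz_x // -{1}sz_w.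
have [w [x [Fw sz_w Hx sz_x]]] := hull_max_sharp n_ge1.
have [le_w Ux] := hull_uniquely_determines Fw Hx.
exists w, (size x - n); split=> //; first by rewrite -sz_w.
by rewrite -Emax -sz_x; lia.
Qed.
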